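(* Let $B\subset\mathbb{R}^n$ be the unit ball of a polyhedral norm. Let $X\subset\mathbb{R}^n$ be a real algebraic variety of codimension $c<n$ and let $N_v\subset\mathbb{R}^n$ be the normal space of $X$ at a smooth point $v\in X$. Then $$\mathrm{Type}(v)=\{F\in\mathcal{F}(B)\mid N_v\cap F^*\neq\emptyset\}.$$
   Context: Polyhedral norm: let $\mathcal{L}$ be a finite set of linear functionals on $\mathbb{R}^n$ with $\mathcal{L}=-\mathcal{L}$ such that $B=\{x\in\mathbb{R}^n\mid \ell(x)\le 1 \text{ for all }\ell\in\mathcal{L}\}$ is a bounded, full-dimensional convex polytope (so $B=-B$). The polyhedral norm is $h(x)=\max_{\ell\in\mathcal{L}}\ell(x)$ and $B$ is its unit ball. $\mathcal{F}(B)$ is the set of proper faces of $B$ (neither $\emptyset$ nor $B$ is included). For $F\in\mathcal{F}(B)$, the inner normal open cone $C(B,F)$ is the open cone of all inner-pointing normal vectors of supporting hyperplanes $H$ of $B$ with $H\cap B=F$; that is, the set of nonzero vectors $w$ such that the functional $x\mapsto w^Tx$ attains its minimum over $B$ exactly on $F$. The dual polytope is $B^*=\{y\in\mathbb{R}^{n*}\mid x^Ty\le 1\ \forall x\in B\}$, and $F^*=\{y\in B^*\mid x^Ty=1\ \forall x\in F\}$ is the face of $B^*$ dual to $F$. $\mathbb{R}^{n*}$ is identified with $\mathbb{R}^n$ via the standard inner product. The normal space $N_v$ of $X$ at a smooth point $v$ is the linear subspace orthogonal to the tangent space of $X$ at $v$. The type of $v$ is $\mathrm{Type}(v)=\{F\in\mathcal{F}(B)\mid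 C(B,F)\cap N_v\ne\emptyset\}$.
   Formalization: The dual face F^* is replaced by its relative interior; with closed F^* the equality fails, e.g. B=[-1,1]^2, X={x_1=0}, v=0, F={(1,1)}: N_v meets F^* at its endpoint e_1, but F is not in Type(v). *)

(* Defs.v *)
From mathcomp Require Export all_boot all_order all_algebra.
From mathcomp Require Export boolp classical_sets cardinality reals.
From mathcomp Require Export mpoly.

Set Implicit Arguments.
Unset Strict Implicit.
Unset Printing Implicit Defensive.

Import Order.TTheory GRing.Theory Num.Theory.
Local Open Scope classical_set_scope.
Local Open Scope ring_scope.

(* Points of R^n and linear functionals on R^n are both row vectors; the
   functional attached to w is [dot w]. *)
Definition dot (R : realType) (n : nat) (x y : 'rV[R]_n) : R :=
  \sum_(i < n) x ord0 i * y ord0 i.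

Section Polytopes.
Variables (R : realType) (n : nat).
Implicit Types (B F S : set 'rV[R]_n) (x y w : 'rV[R]_n).

Definition full_dimensional B : Prop :=
  forall w (b : R), (forall x, B x -> dot w x = b) -> w = 0.

Definition bounded B : Prop :=
  exists M : R, forall x, B x -> forall i, `|x ord0 i| <= M.

(* The norm itself is h(x) = max_(l in L) dot l x, so B = [set x | h x <= 1]. *)
Definition polyhedral_unit_ball B : Prop :=
  exists L : set 'rV[R]_n,
    [/\ finite_set L,
        forall l, L l -> L (- l),
        B = [set x | forall l, L l -> dot l x <= 1],
        bounded B
      & full_dimensional B].

Definition face B F : Prop :=
  exists w (a : R), (forall x, B x -> dot w x <= a) /\
    F = [set x | B x /\ dot w x = a].

Definition proper_face B F : Prop := [/\ face B F, F <> set0 & F <> B].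

Definition inner_normal_cone B F : set 'rV[R]_n :=
  [set w | w <> 0 /\
     F = [set x | B x /\ forall y, B y -> dot w x <= dot w y]].

Definition dual_polytope B : set 'rV[R]_n :=
  [set y | forall x, B x -> dot x y <= 1].

Definition dual_face B F : set 'rV[R]_n :=
  [set y | dual_polytope B y /\ forall x, F x -> dot x y = 1].

Definition affine_subspace S : Prop :=
  forall x y (t : R), S x -> S y -> S ((1 - t) *: x + t *: y).

Definition affine_hull S : set 'rV[R]_n :=
  [set x | forall A : set 'rV[R]_n, affine_subspace A -> S `<=` A -> A x].

Definition relative_interior S : set 'rV[R]_n :=
  [set x | S x /\ exists2 e : R, 0 < e &
     forall y, affine_hull S y ->
       (forall i, `|y ord0 i - x ord0 i| < e) -> S y].

End Polytopes.

Section Varieties.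
Variables (R : realType) (n : nat).
Implicit Types (X Y Z : set 'rV[R]_n) (v u w : 'rV[R]_n) (p : {mpoly R[n]}).

Definition peval p v : R := p.@[fun i => v ord0 i].

Definition gradient p v : 'rV[R]_n := \row_i peval (mderiv i p) v.

Definition algebraic_set X : Prop :=
  exists ps : seq {mpoly R[n]},
    X = [set x | forall p, p \in ps -> peval p x = 0].

Definition vanishing_ideal X : set {mpoly R[n]} :=
  [set p | forall x, X x -> peval p x = 0].

Definition irreducible_set X : Prop :=
  [/\ algebraic_set X, X <> set0
    & forall Y Z, algebraic_set Y -> algebraic_set Z ->
        X = Y `|` Z -> X = Y \/ X = Z].

(* Krull dimension for the real Zariski topology: X contains a strictly
   increasing chain Z_0 < ... < Z_d of irreducible algebraic sets. *)
Definition irreducible_chain X (d : nat) : Prop :=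
  exists Z : nat -> set 'rV[R]_n,
    (forall i, (i <= d)%N -> irreducible_set (Z i) /\ Z i `<=` X) /\
    (forall i, (i < d)%N -> Z i `<` Z i.+1).

Definition has_dimension X (d : nat) : Prop :=
  irreducible_chain X d /\ ~ irreducible_chain X d.+1.

Definition has_codimension X (c : nat) : Prop :=
  exists2 d, has_dimension X d & (d + c)%N = n.

Definition tangent_space X v : set 'rV[R]_n :=
  [set u | forall p, vanishing_ideal X p -> dot (gradient p v) u = 0].

(* Jacobian criterion: the Zariski tangent space has dimension dim X. *)
Definition smooth_point X v : Prop :=
  X v /\ exists2 d, has_dimension X d &
    exists2 U : {vspace 'rV[R]_n},
      (forall u, u \in U <-> tangent_space X v u) & \dim U = d.

Definition normal_space X v : set 'rV[R]_n :=
  [set w | forall u, tangent_space X v u -> dot w u = 0].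

Definition point_type (B X : set 'rV[R]_n) v : set (set 'rV[R]_n) :=
  [set F | proper_face B F /\
     inner_normal_cone B F `&` normal_space X v !=set0].

End Varieties.

(* The faces of the dual polytope are met in their relative interiors: with
   closed dual faces only an inclusion holds.  For B = [-1, 1]^2 and the line
   X = {x_1 = 0}, the normal line meets the closed face dual to the vertex
   (1, 1) at its end point (1, 0), but this vertex is not in the type. *)
Definition open_dual_face (R : realType) (n : nat) (B F : set 'rV[R]_n) :
    set 'rV[R]_n :=
  relative_interior (dual_face B F).

(* Main.v *)
Require Import Defs.
From mathcomp Require Import zify ring lra.
Import Order.TTheory GRing.Theory Num.Theory.
Local Open Scope classical_set_scope.
Local Open Scope ring_scope.

(** After rescaling, a normal vector in the cone of [F] becomes [- y] where [y]
    has maximum 1 over [B], attained exactly on [F]; so it suffices to see that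
    the relative interior of the dual face consists of these [y].  If [y] is
    relatively interior and [y0] is a point of the dual face exposing [F], then
    pushing [y] slightly away from [y0] stays in the dual face, which forces
    [y0 = 1] wherever [y = 1].  Conversely, if [y] exposes [F], a functional
    near [y] that equals 1 on [F] remains at most 1 at the finitely many
    vertices of [B] outside [F], hence on [B]. *)

(** * Bilinearity of the pairing and stability of strict inequalities *)

Section Dot.
Variables (R : realType) (n : nat).
Implicit Types (x y z w d : 'rV[R]_n).

Lemma dotC x y : dot x y = dot y x.
Proof. by apply: eq_bigr => i _; rewrite mulrC. Qed.

Lemma dotDr x y z : dot x (y + z) = dot x y + dot x z.
Proof. by rewrite /dot -big_split /=; apply: eq_bigr => i _; rewrite mxE mulrDr. Qed.

Lemma dotZr x (t : R) y : dot x (t *: y) = t * dot x y.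
Proof. by rewrite /dot mulr_sumr; apply: eq_bigr => i _; rewrite mxE mulrCA. Qed.

Lemma dotNr x y : dot x (- y) = - dot x y.
Proof. by rewrite -scaleN1r dotZr mulN1r. Qed.

Lemma dot0r x : dot x 0 = 0.
Proof. by rewrite -(scale0r x) dotZr mul0r. Qed.

Lemma dotDl x y z : dot (y + z) x = dot y x + dot z x.
Proof. by rewrite dotC dotDr !(dotC x). Qed.

Lemma dotZl x (t : R) y : dot (t *: y) x = t * dot y x.
Proof. by rewrite dotC dotZr dotC. Qed.

Lemma dotNl x y : dot (- y) x = - dot y x.
Proof. by rewrite dotC dotNr dotC. Qed.

Lemma dot0l x : dot 0 x = 0.
Proof. by rewrite dotC dot0r. Qed.

Lemma dot_lt1_stable x y : dot x y < 1 ->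
  exists2 e : R, 0 < e &
    forall z, (forall i, `|z ord0 i - y ord0 i| < e) -> dot x z <= 1.
Proof.
move=> xy1; set s := \sum_i `|x ord0 i|.
have s0 : 0 <= s by apply: sumr_ge0.
have s1 : 0 < s + 1 by lra.
(* Moving each coordinate of [y] by less than [e] changes [dot x y] by at most [s * e]; the [+ 1]
   keeps the denominator positive when [x = 0]. *)
exists ((1 - dot x y) / (s + 1)); first by rewrite divr_gt0 // subr_gt0.
set e := _ / _ => z zy.
have e0 : 0 <= e by rewrite divr_ge0 // ltW // subr_gt0.
have es : e * (s + 1) = 1 - dot x y by rewrite /e divfK // gt_eqF.
suff : dot x (z - y) <= s * e by rewrite dotDr dotNr; lra.
rewrite /dot /s mulr_suml; apply: ler_sum => i _.
rewrite !mxE; apply: (le_trans (ler_norm _)); rewrite normrM.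
by apply: ler_wpM2l => //; exact: ltW.
Qed.

Lemma dots_lt1_stable (s : seq 'rV[R]_n) y :
  exists2 e : R, 0 < e &
    forall z, (forall i, `|z ord0 i - y ord0 i| < e) ->
      forall x, x \in s -> dot x y < 1 -> dot x z <= 1.
Proof.
elim: s => [|a s [e e0 es]]; first by exists 1.
have [ay|ay] := ltP (dot a y) 1; last first.
  exists e => // z zy x; rewrite inE => /orP[/eqP ->|]; last exact: es.
  by rewrite ltNge ay.
have [f f0 fa] := dot_lt1_stable _ _ ay.
exists (Num.min e f); first by rewrite lt_min e0.
move=> z zy x; rewrite inE => /orP[/eqP -> _|].
  by apply: fa => i; have := zy i; rewrite lt_min => /andP[].
by apply: es => i; have := zy i; rewrite lt_min => /andP[].
Qed.

End Dot.

(** * Vertices of a bounded polyhedron and maxima of linear functionals *)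

Section Vertices.
Variables (R : realType) (n : nat) (I : finType) (l : I -> 'rV[R]_n).
Implicit Types (x y z w d : 'rV[R]_n).

Let B : set 'rV[R]_n := [set x | forall i, dot (l i) x <= 1].
Hypothesis bB : bounded B.

Definition tight x : {set I} := [set i | dot (l i) x == 1]%SET.

(** Algebraic form of an extreme point: the functionals tight at [x] span the dual space. *)
Definition vertex x : Prop :=
  B x /\ forall d, (forall i, i \in tight x -> dot (l i) d = 0) -> d = 0.

(** This bounds the number of vertices by the number of subsets of [I]: every functional tight at
    both points kills [x - y]. *)
Lemma vertex_tight_inj x y : vertex x -> vertex y -> tight x = tight y -> x = y.
Proof.
move=> [_ vx] _ xy; apply/eqP; rewrite -subr_eq0; apply/eqP/vx => i ix.
have := ix; rewrite {1}xy; move: ix; rewrite !inE => /eqP ix /eqP iy.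
by rewrite dotDr dotNr ix iy subrr.
Qed.

(** Otherwise the whole ray from [x] along [d] would stay in [B]. *)
Lemma bounded_exit_direction x d : B x -> d != 0 -> exists i, 0 < dot (l i) d.
Proof.
move=> Bx d0; apply: contrapT => /forallNP ld.
have [M HM] := bB.
have [j dj] : exists j, d ord0 j != 0.
  apply: contrapT => /forallNP d0'; move/eqP: d0; apply.
  by apply/rowP => j; rewrite mxE; have /negP := d0' j; rewrite negbK => /eqP.
(* With this [t], coordinate [j] of [x + t *: d] has absolute value at least [M + 1]. *)
set t := (M + 1 + `|x ord0 j|) / `|d ord0 j|.
have M0 : 0 <= M by apply: le_trans (HM _ Bx j).
have t0 : 0 <= t by rewrite divr_ge0 // !addr_ge0.
have /HM/(_ j) : B (x + t *: d).
  move=> i; rewrite dotDr dotZr; have := Bx i; have /negP := ld i.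
  by rewrite -leNgt => /(mulr_ge0_le0 t0); lra.
rewrite !mxE => H.
have : `|t * d ord0 j| <= `|x ord0 j + t * d ord0 j| + `|x ord0 j|.
  rewrite -[X in `|X| <= _](addKr (x ord0 j)) addrC.
  by apply: le_trans (ler_normD _ _) _; rewrite normrN.
rewrite normrM (ger0_norm t0) /t divfK ?normr_eq0 //; lra.
Qed.

Lemma tight_extend x d : B x -> d != 0 ->
    (forall i, i \in tight x -> dot (l i) d = 0) ->
  exists2 t : R, 0 <= t & B (x + t *: d) /\ tight x \proper tight (x + t *: d).
Proof.
move=> Bx d0 xd; have [i0 i0d] := bounded_exit_direction _ _ Bx d0.
(* [f i] is the time at which the ray reaches constraint [i]; the ray is stopped at the first
   constraint [k] that it meets. *)
pose f i := (1 - dot (l i) x) / dot (l i) d.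
have [k kd kmin] := @arg_minP _ _ _ i0 (fun i => 0 < dot (l i) d) f i0d.
have fk : f k * dot (l k) d = 1 - dot (l k) x by rewrite /f divfK ?gt_eqF.
have fk0 : 0 <= f k by apply: divr_ge0; [rewrite subr_ge0; exact: Bx | exact: ltW].
exists (f k) => //; split.
  move=> i; rewrite dotDr dotZr; have [id|id] := ltP 0 (dot (l i) d).
    by have := kmin i id; rewrite {2}/f ler_pdivlMr //; lra.
  by have := Bx i; have := mulr_ge0_le0 fk0 id; lra.
rewrite properE; apply/andP; split.
  apply/fintype.subsetP => i ix; have := ix; rewrite !inE => /eqP ix1.
  by rewrite dotDr dotZr xd // mulr0 addr0 ix1.
apply/fintype.subsetPn; exists k.
  by rewrite inE dotDr dotZr fk addrC subrK.
by apply/negP => /xd kd0; rewrite kd0 ltxx in kd.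
Qed.

(** Induction on the number of constraints not tight at [x]: a point that is not a vertex can move,
    without decreasing [dot z], until a further constraint becomes tight. *)
Lemma le_dot_vertex z x : B x -> exists2 y, vertex y & dot z x <= dot z y.
Proof.
have [k] := ubnP #|~: tight x|; elim: k x => // k IH x; rewrite ltnS => xk Bx.
have [vx|nvx] := pselect (vertex x); first by exists x.
have [d [xd d0]] : exists d, (forall i, i \in tight x -> dot (l i) d = 0) /\ d != 0.
  apply: contrapT => /forallNP nd; apply: nvx; split=> // d xd.
  by apply/eqP/negPn/negP => d0; apply: (nd d).
(* The conditions on [d] are invariant under sign, so [d] can be oriented towards larger values of
   [dot z]. *)
have {d xd d0} [d [xd d0 zd]] : exists d,
    [/\ forall i, i \in tight x -> dot (l i) d = 0, d != 0 & 0 <= dot z d].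
  have [zd|zd] := leP 0 (dot z d); first by exists d.
  exists (- d); split; rewrite ?oppr_eq0 // ?dotNr ?oppr_ge0 ?ltW //.
  by move=> i ix; rewrite dotNr xd // oppr0.
have [t t0 [Bt /proper_card ct]] := tight_extend _ _ Bx d0 xd.
have [|y vy zy] := IH (x + t *: d) _ Bt.
  apply: leq_trans xk; have := cardsC (tight x).
  have := cardsC (tight (x + t *: d)); lia.
exists y => //; apply: le_trans zy.
by rewrite dotDr dotZr lerDl mulr_ge0.
Qed.

Lemma finite_vertices : exists s : seq 'rV[R]_n,
  (forall x, x \in s -> B x) /\
  forall z x, B x -> exists2 y, y \in s & dot z x <= dot z y.
Proof.
(* The default 0, used when no vertex has tight set [T], also lies in [B]. *)
pose v (T : {set I}) := xget 0 [set x | vertex x /\ tight x = T].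
exists [seq v T | T <- enum {: {set I}}]; split.
  move=> _ /mapP[T _ ->]; rewrite /v; case: xgetP => [x _ [[]] //|_ i].
  by rewrite dot0r ler01.
move=> z x /(le_dot_vertex z)[y vy zy]; exists y => //.
apply/mapP; exists (tight y); rewrite ?mem_enum // /v.
case: xgetP => [x' _ [vx' xy']|/(_ y)]; last by case.
by apply: vertex_tight_inj.
Qed.

End Vertices.

(** * Relative interiors of dual faces and exposing functionals *)

Section UnitBall.
Variables (R : realType) (n : nat) (B : set 'rV[R]_n).
Hypothesis hB : polyhedral_unit_ball B.
Implicit Types (F : set 'rV[R]_n) (x y z w : 'rV[R]_n).

Lemma unit_ball0 : B 0.
Proof. by case: hB => L [_ _ -> _ _] l _; rewrite dot0r ler01. Qed.

Lemma unit_ballN x : B x -> B (- x).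
Proof.
case: hB => L [_ LN -> _ _] Bx l Ll.
by rewrite dotNr -dotNl; apply: Bx; apply: LN.
Qed.

Lemma unit_ball_vertices : exists s : seq 'rV[R]_n,
  (forall x, x \in s -> B x) /\
  forall z x, B x -> exists2 y, y \in s & dot z x <= dot z y.
Proof.
case: hB => L [/finite_seqP[s Ls] _ BL bB _].
have BE : B = [set x | forall i : seq_sub s, dot (val i) x <= 1].
  rewrite BL Ls; apply/seteqP; split=> x /= Bx => [i|i si].
    by apply: Bx; exact: valP.
  exact: (Bx (SeqSub si)).
have := @finite_vertices R n (seq_sub s) val.
by rewrite -BE; apply.
Qed.

Lemma unit_ball_dot_le0 w : (forall x, B x -> dot w x <= 0) ->
  forall x, B x -> dot w x = 0.
Proof.
move=> wB x Bx; apply: le_anti; rewrite wB //=.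
by have := wB _ (unit_ballN _ Bx); rewrite dotNr oppr_le0.
Qed.

Lemma exposed_open_dual_face F y :
    (forall x, B x -> dot y x <= 1) -> F = [set x | B x /\ dot y x = 1] ->
  open_dual_face B F y.
Proof.
move=> yB FE; have Fy : dual_face B F y.
  by split=> x; rewrite dotC; [exact: yB | rewrite FE => -[]].
split=> //; have [s [sB sV]] := unit_ball_vertices.
have [e e0 es] := dots_lt1_stable _ _ s y; exists e => // z hz zy.
have Fz x : F x -> dot x z = 1.
  (* This hyperplane contains the dual face, hence also its affine hull. *)
  move=> Fx; apply: (hz [set u | dot x u = 1]); last by move=> u [_]; apply.
  move=> u u' t /= xu xu'; rewrite dotDr !dotZr xu xu'; lra.
split=> // x Bx; have [u us] := sV z x Bx; rewrite dotC => /le_trans; apply.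
rewrite dotC; have /orP[/eqP yu|yu] : (dot y u == 1) || (dot y u < 1).
- by rewrite -le_eqVlt; apply/yB/sB.
- by rewrite Fz // FE; split=> //; exact: sB.
- by apply: (es _ zy) => //; rewrite dotC.
Qed.

(** The maximum [a] can be scaled to 1 because it is positive: if it were 0, symmetry of [B] would
    make [w] vanish on [B], so that [F = B]. *)
Lemma proper_face_exposed F : proper_face B F ->
  exists2 y, (forall x, B x -> dot y x <= 1) & F = [set x | B x /\ dot y x = 1].
Proof.
case=> -[w [a [wB FE]]] F0 FB.
have a0 : 0 < a.
  have := wB _ unit_ball0; rewrite dot0r le_eqVlt => /orP[/eqP a0|//].
  exfalso; apply: FB; rewrite FE; apply/seteqP; split=> x /=; first by case.
  move=> Bx; split=> //; rewrite -a0; apply: unit_ball_dot_le0 => // u /wB.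
  by rewrite a0.
exists (a^-1 *: w) => [x /wB|].
  by rewrite dotZl mulrC ler_pdivrMr // mul1r.
rewrite FE; apply/seteqP; split=> x /= [Bx wx]; split=> //.
  by rewrite dotZl wx mulVf // gt_eqF.
by move: wx; rewrite dotZl => /(canRL (mulVKf _)) ->; rewrite ?mulr1 ?gt_eqF.
Qed.

Lemma open_dual_face_exposed F y : proper_face B F -> open_dual_face B F y ->
  F = [set x | B x /\ dot y x = 1].
Proof.
move=> /proper_face_exposed[y0 y0B FE] [[yB Fy] [e e0 he]].
have FB x : F x -> B x by rewrite FE => -[].
have Fy0 : dual_face B F y0.
  by split=> x; rewrite dotC; [exact: y0B | rewrite FE => -[]].
apply/seteqP; split=> x /=.
  by move=> Fx; split; [exact: FB | rewrite dotC Fy].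
move=> [Bx yx].
set m : R := \sum_i `|y ord0 i - y0 ord0 i|.
have m0 : 0 <= m by apply: sumr_ge0.
have m1 : 0 < m + 1 by lra.
(* Small enough that [y + t (y - y0)] differs from [y] by less than [e] in every coordinate. *)
pose t := e / (m + 1).
have t0 : 0 < t by rewrite divr_gt0.
have tm : t * (m + 1) = e by rewrite /t divfK // gt_eqF.
have [/(_ _ Bx) + _] : dual_face B F ((1 - - t) *: y + (- t) *: y0).
  apply: he => [A Aaff FA|i]; first by apply: Aaff; apply: FA.
  rewrite !mxE.
  have -> : (1 - - t) * y ord0 i + - t * y0 ord0 i - y ord0 i
    = t * (y ord0 i - y0 ord0 i) by ring.
  rewrite normrM gtr0_norm // -tm ltr_pM2l //.
  rewrite (le_lt_trans (_ : _ <= m)) // ?ltrDl //.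
  by rewrite /m (bigD1 i) //= lerDl sumr_ge0.
(* At [x] the pushed point gives [(1 + t) - t * dot y0 x <= 1], hence [dot y0 x >= 1]. *)
rewrite dotDr !dotZr !(dotC _ _ x) yx => H.
rewrite FE; split=> //; apply: le_anti; rewrite y0B //=.
by rewrite -(ler_pM2l t0); lra.
Qed.

End UnitBall.

(** * Rescaling between inner normals and dual points *)

Lemma normal_spaceZ (R : realType) (n : nat) (X : set 'rV[R]_n) v (t : R) w :
  normal_space X v w -> normal_space X v (t *: w).
Proof. by move=> Nw u /Nw wu; rewrite dotZl wu mulr0. Qed.

Theorem theorem3p6 (R : realType) (n : nat) (B : set 'rV[R]_n)
    (hB : polyhedral_unit_ball B)
    (X : set 'rV[R]_n) (hX : algebraic_set X)
    (c : nat) (hc : has_codimension X c) (hcn : (c < n)%N)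
    (v : 'rV[R]_n) (hv : smooth_point X v) :
  point_type B X v =
    [set F | proper_face B F /\
       normal_space X v `&` open_dual_face B F !=set0].
Proof.
apply/seteqP; split=> F /= [pF]; have [_ /eqP/set0P[x0 Fx0] _] := pF.
  move=> [w [[w0 FE] Nw]]; split=> //.
  have [Bx0 wx0] : B x0 /\ forall y, B y -> dot w x0 <= dot w y.
    by move: Fx0; rewrite FE.
  (* [s] is the maximum of [- w] over [B]. If it were 0, symmetry would make [w] vanish on [B], and
     full dimensionality would force [w = 0]. Dividing [- w] by [s] brings the maximum to 1. *)
  pose s := - dot w x0.
  have s0 : 0 < s.
    have : 0 <= s by rewrite oppr_ge0 -(dot0r _ _ w) wx0 //; exact: unit_ball0.
    rewrite le_eqVlt => /orP[/eqP s0|//]; exfalso; apply: w0.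
    case: (hB) => L [_ _ _ _ /(_ w 0)]; apply=> x Bx; apply: oppr_inj.
    rewrite -dotNl oppr0; apply: (unit_ball_dot_le0 _ _ _ hB) => // u Bu.
    by have := wx0 u Bu; rewrite dotNl; move: s0; rewrite /s; lra.
  have sE : - s^-1 * dot w x0 = 1 by rewrite mulNr -mulrN mulVf // gt_eqF.
  exists ((- s^-1) *: w); split; first exact: normal_spaceZ.
  apply: exposed_open_dual_face => // [x Bx|].
    rewrite dotZl -sE; apply: ler_wnM2l; last exact: wx0.
    by rewrite oppr_le0 invr_ge0 ltW.
  rewrite {1}FE; apply/seteqP; split=> x /= [Bx wx]; split=> //.
    by rewrite dotZl -sE; congr (_ * _); apply: le_anti; rewrite wx ?wx0.
  move=> u Bu; suff -> : dot w x = dot w x0 by exact: wx0.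
  apply: (@mulfI _ (- s^-1)); last by rewrite sE -dotZl.
  by rewrite oppr_eq0 invr_eq0 gt_eqF.
move=> [y [Ny Oy]]; split=> //.
have FE := open_dual_face_exposed _ _ _ hB _ _ pF Oy.
have [[yB _] _] := Oy.
have [Bx0 yx0] : B x0 /\ dot y x0 = 1 by move: Fx0; rewrite FE.
(* The sign turns the maximum of [y] on [F] into the minimum required of an inner normal. *)
exists (- y); split; last by rewrite -scaleN1r; exact: normal_spaceZ.
split.
  by move=> y0; move: yx0; rewrite -[y]opprK y0 dotNl dot0l; lra.
rewrite {1}FE; apply/seteqP; split=> x /= [Bx yx]; split=> //.
  by move=> u /yB; rewrite !dotNl yx dotC lerN2.
apply: le_anti; rewrite dotC yB //= dotC.
by have := yx _ Bx0; rewrite !dotNl lerN2 yx0.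
Qed.
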